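(* Let $m\ge 2$, $n\ge 2$ be integers. Then the average cardinality of the minimal teaching sets of threshold functions on $E_m\times E_n$ satisfies $$\overline{\sigma}(m,n) = \frac{4\, f_1(m,n)-2\, f_2(m,n)}{f_1(m,n)+2}.$$
   Context: Let $E_k=\{0,1,\dots,k-1\}$. A function $g:E_m\times E_n\to\{0,1\}$ is a threshold function if there exist real $a_0,a_1,a_2$ with $\{x\in E_m\times E_n: g(x)=0\}=\{(x_1,x_2)\in E_m\times E_n: a_1x_1+a_2x_2\le a_0\}$. Let $\mathcal{T}(m,n)$ be the set of all threshold functions on $E_m\times E_n$ and $t(m,n)=|\mathcal{T}(m,n)|$. A set $T\subseteq E_m\times E_n$ is teaching for $g\in\mathcal{T}(m,n)$ if for every $h\in\mathcal{T}(m,n)$ with $h\ne g$ there is $x\in T$ with $g(x)\ne h(x)$; it is minimal if no proper subset is teaching for $g$. It is known that every $g\in\mathcal{T}(m,n)$ has a unique minimal teaching set, denoted $T(g)$. Define $\overline{\sigma}(m,n)=\frac{1}{t(m,n)}\sum_{g\in\mathcal{T}(m,n)}|T(g)|$. For a positive integer $q$, define $$f_q(m,n)=\sum_{\substack{-m<i<m,\ -n<j<n\\ \gcd(i,j)=q}}(m-|i|)(n-|j|),$$ the sum over integers $i,j$. *)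

(* Defs.v *)
From HB Require Import structures.
From mathcomp Require Import all_boot all_order all_algebra.
From mathcomp Require Import boolp reals.
From mathcomp Require Import zify.

Set Implicit Arguments.
Unset Strict Implicit.
Unset Printing Implicit Defensive.

Import Order.TTheory GRing.Theory Num.Theory.

Local Open Scope ring_scope.

Definition is_threshold (R : realType) (m n : nat)
    (g : {ffun 'I_m * 'I_n -> bool}) : Prop :=
  exists a0 a1 a2 : R, forall x : 'I_m * 'I_n,
    g x = false <-> a1 * (x.1)%:R + a2 * (x.2)%:R <= a0.

Definition thresholds (R : realType) (m n : nat) :
    {set {ffun 'I_m * 'I_n -> bool}} :=
  [set g | `[< is_threshold R g >]].

Definition teaching (R : realType) (m n : nat)
    (g : {ffun 'I_m * 'I_n -> bool}) (T : {set 'I_m * 'I_n}) : bool :=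
  [forall h in thresholds R m n, (h != g) ==> [exists x in T, g x != h x]].

(* [minset p A] says that A satisfies p and that no proper subset of A does.
   The full grid is teaching, so the [None] branch of the choice never occurs. *)
Definition min_teaching_set (R : realType) (m n : nat)
    (g : {ffun 'I_m * 'I_n -> bool}) : {set 'I_m * 'I_n} :=
  odflt set0 [pick T : {set 'I_m * 'I_n} | minset (teaching R g) T].

Lemma minset_min_teaching_set (R : realType) (m n : nat)
    (g : {ffun 'I_m * 'I_n -> bool}) :
  minset (teaching R g) (min_teaching_set R g).
Proof.
rewrite /min_teaching_set; case: pickP => [T //|noT] /=.
have fullT : teaching R g [set: 'I_m * 'I_n].
  apply/forall_inP => h _; apply/implyP => neq_hg.
  apply: contraNT neq_hg => /exists_inPn eq_gh.
  apply/eqP/ffunP => x.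
  by have := eq_gh x (in_setT x); rewrite negbK => /eqP.
by have [T minT _] := minset_exists fullT; rewrite noT in minT.
Qed.

Definition avg_teaching (R : realType) (m n : nat) : rat :=
  (\sum_(g in thresholds R m n) #|min_teaching_set R g|)%N%:R
    / #|thresholds R m n|%:R.

Definition int_range (k : nat) : seq int :=
  [seq i%:Z - k%:Z + 1 | i <- iota 0 (2 * k - 1)].

Lemma mem_int_range (k : nat) (i : int) :
  (i \in int_range k) = (- k%:Z < i < k%:Z).
Proof.
apply/mapP/idP => [[a]|/andP[lti ltk]].
  rewrite mem_iota add0n => /andP[_ lta] ->; apply/andP; split; lia.
exists (absz (i + k%:Z - 1)%R); last lia.
rewrite mem_iota; lia.
Qed.

Lemma int_range_uniq (k : nat) : uniq (int_range k).
Proof. by rewrite map_inj_uniq ?iota_uniq // => a b; lia. Qed.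

Definition fq (q m n : nat) : int :=
  \sum_(i <- int_range m) \sum_(j <- int_range n | gcdz i j == q%:Z)
    (m%:Z - `|i|) * (n%:Z - `|j|).

(* Main.v *)
Require Import Defs.
From HB Require Import structures.
From mathcomp Require Import all_boot all_order all_algebra.
From mathcomp Require Import boolp reals.
From mathcomp Require Import ring lra zify.

Import Order.TTheory GRing.Theory Num.Theory.

Set Implicit Arguments.
Unset Strict Implicit.
Unset Printing Implicit Defensive.

Local Open Scope ring_scope.

(** A point [x] lies in the minimal teaching set of a threshold function [g]
exactly when flipping [g] at [x] gives a threshold function: two distinct threshold
functions are joined by a pencil of generic affine functionals, which crosses the
points where they differ one at a time. So the total size of the teaching sets is
twice the number of pairs [(A, x)] with [x] outside [A] such that [A] and [A + x] are
both separable from their complements.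

For every nonempty finite planar set [X], the number of separable subsets is
[2 + adj X], where [adj X] counts the ordered pairs of distinct points of [X] with no
point of [X] strictly between them: a nontrivial separation corresponds to the segment
joining its two sides on one of their two inner common tangents. Deleting [x] from
[X] shows that the number of [A] as above is [adj X - adj (X - x)]. The sum over [x]
is twice [adj X] minus the number of pairs with exactly one point of [X] between
them. In the grid, the number of points strictly between two points is the gcd of the
coordinate differences minus one, so that these two counts are [f_1] and [f_2]. *)

(** * Small perturbations over a finite set *)

(** Each point allows a positive bound on [e], and the minimum of finitely many is positive. The
    denominator [1 + |g z|] keeps the bound defined where [g] vanishes. *)
Lemma perturbation (R : realFieldType) (T : finType) (f g : T -> R) :
  exists2 e : R, 0 < e & forall y, f y != 0 -> e * `|g y| < `|f y|.
Proof.
suff [e e0 He] : exists2 e : R, 0 < e &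
    forall y, y \in enum T -> f y != 0 -> e * `|g y| < `|f y|.
  by exists e => // y; apply: He; rewrite mem_enum.
elim: (enum T) => [|z s [e e0 IH]]; first by exists 1.
have [fz0|fz0] := eqVneq (f z) 0.
  by exists e => // y; rewrite inE => /orP[/eqP->|/IH//]; rewrite fz0 eqxx.
have nf : 0 < `|f z| by rewrite normr_gt0.
have ng : 0 <= `|g z| by rewrite normr_ge0.
pose d := `|f z| / (1 + `|g z|).
have d0 : 0 < d by apply: divr_gt0 => //; lra.
have dE : d * (1 + `|g z|) = `|f z| by rewrite divfK //; apply: lt0r_neq0; lra.
exists (Num.min e d); first by rewrite lt_min e0.
move=> y; rewrite inE => /orP[/eqP-> _|ys fy].
  apply: le_lt_trans (_ : d * `|g z| < _); last by lra.
  by apply: ler_wpM2r => //; rewrite ge_min lexx orbT.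
apply: le_lt_trans (IH y ys fy).
by apply: ler_wpM2r => //; rewrite ge_min lexx.
Qed.

(** * Separable subsets of a finite planar set *)

Section Points.
Context (R : realFieldType) (T : finType) (cx cy : T -> R).
Hypothesis cxyI : forall p q, cx p = cx q -> cy p = cy q -> p = q.

Implicit Types (X A : {set T}) (p q x y : T).

Definition aff (a b c : R) y := a * cx y + b * cy y + c.

(** Strict on both sides, so that the condition survives small perturbations; [separable_sign]
    recovers the form in which zeros count as outside. *)
Definition separates (f : T -> R) A y := if y \in A then 0 < f y else f y < 0.

Definition separable X A :=
  (A \subset X) &&
  `[< exists a b c : R, forall y, y \in X -> separates (aff a b c) A y >].

Lemma separableP X A :
  reflect (A \subset X /\ exists a b c : R,
             forall y, y \in X -> separates (aff a b c) A y)
          (separable X A).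
Proof. by apply: (iffP andP) => -[? /asboolP]. Qed.

(** For small [e], the sign of [f + e * g] is that of [f] where [f] is nonzero and that of [g] on
    the zeros of [f]. *)
Lemma separates_perturb X A (f g : T -> R) :
  (forall y, y \in X -> f y != 0 -> separates f A y) ->
  (forall y, y \in X -> f y = 0 -> separates g A y) ->
  exists2 e : R, 0 < e &
    forall y, y \in X -> separates (fun z => f z + e * g z) A y.
Proof.
move=> Hf Hg; have [e e0 He] := perturbation f g.
exists e => // y yX; rewrite /separates.
have [fy0|fy0] := eqVneq (f y) 0.
  move: (Hg y yX fy0); rewrite /separates fy0.
  case: ifP => _ ?; nra.
have := He y fy0; move: (Hf y yX fy0); rewrite /separates.
have h : `|e * g y| = e * `|g y| by rewrite normrM (gtr0_norm e0).
rewrite -h; case: ifP => _ fs.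
  by rewrite (gtr0_norm fs) ltr_norml => /andP[? ?]; lra.
by rewrite (ltr0_norm fs) ltr_norml => /andP[? ?]; lra.
Qed.

(** * Separations attached to adjacent pairs *)

(** The determinant of [q - p] and [y - p], positive to the left of the line directed from [p] to
    [q]; [along] is their inner product. *)
Definition cross p q y :=
  (cx q - cx p) * (cy y - cy p) - (cy q - cy p) * (cx y - cx p).
Definition along p q y :=
  (cx q - cx p) * (cx y - cx p) + (cy q - cy p) * (cy y - cy p).

Definition between p q y := (cross p q y == 0) && (0 < along p q y < along p q q).

Definition adjacent_pairs X : {set T * T} :=
  [set u in setX X X | (u.1 != u.2) && [forall y in X, ~~ between u.1 u.2 y]].

(** The open left half plane together with the open ray of its boundary line that starts at [u.1]
    and runs through [u.2]. *)
Definition left_of X u : {set T} :=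
  [set y in X | (0 < cross u.1 u.2 y) ||
                (cross u.1 u.2 y == 0) && (0 < along u.1 u.2 y)].

Lemma along_gt0 p q : p != q -> 0 < along p q q.
Proof.
move=> npq; rewrite /along -!expr2.
have [Ex|Nx] := eqVneq (cx q) (cx p); last first.
  apply: ltr_wpDr; first exact: sqr_ge0.
  by rewrite exprn_even_gt0 //= subr_eq0.
have [Ey|Ny] := eqVneq (cy q) (cy p); first by rewrite (@cxyI p q) ?eqxx in npq.
apply: ltr_wpDl; first exact: sqr_ge0.
by rewrite exprn_even_gt0 //= subr_eq0.
Qed.

Lemma adjacent_pairsP X p q :
  reflect [/\ p \in X, q \in X, p != q & forall y, y \in X -> ~~ between p q y]
          ((p, q) \in adjacent_pairs X).
Proof.
rewrite inE in_setX /= -!andbA.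
by apply: (iffP and4P) => -[? ? ?] /forall_inP.
Qed.

Lemma left_of_separable X p q :
  (p, q) \in adjacent_pairs X -> separable X (left_of X (p, q)).
Proof.
case/adjacent_pairsP => pX qX npq adj; apply/separableP; split.
  by apply/subsetP => y; rewrite inE => /andP[].
have d0 := along_gt0 npq.
have [y yX f0|y yX f0|e e0 He] := @separates_perturb X (left_of X (p, q))
  (cross p q) (fun y => 2 * along p q y - along p q q).
- rewrite /separates inE yX (negPf f0) /= orbF.
  by case: ltP => // h; rewrite lt_neqAle f0.
- rewrite /separates inE yX f0 ltxx eqxx /=.
  have := adj y yX; rewrite /between f0 eqxx /= negb_and -!leNgt.
  by case: ltP => h /=; lra.
pose dx := cx q - cx p; pose dy := cy q - cy p.
exists (- dy + e * 2 * dx), (dx + e * 2 * dy),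
  (dy * cx p - dx * cy p + e * (- 2 * (dx * cx p + dy * cy p) - along p q q)).
move=> y yX; have := He y yX; rewrite /separates.
rewrite (_ : aff _ _ _ y = cross p q y + e * (2 * along p q y - along p q q)) //.
by rewrite /aff /cross /along /dx /dy; ring.
Qed.

Lemma left_of_head X p q : (p, q) \in adjacent_pairs X -> q \in left_of X (p, q).
Proof.
case/adjacent_pairsP => pX qX npq _; rewrite inE qX /= along_gt0 //.
by rewrite (_ : cross p q q = 0) ?eqxx ?orbT // /cross; ring.
Qed.

Lemma left_of_tail X p q : p \notin left_of X (p, q).
Proof.
have h1 : cross p q p = 0 by rewrite /cross; ring.
have h2 : along p q p = 0 by rewrite /along; ring.
by apply/negP; rewrite inE /= h1 h2 ltxx andbF /= andbF.
Qed.

Lemma in_left_of X p q y : y \in left_of X (p, q) ->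
  0 <= cross p q y /\ (cross p q y = 0 -> 0 < along p q y).
Proof.
rewrite inE => /andP[_ /orP[/= h|/andP[/eqP /= -> h]]]; last by [].
by split=> [|e]; [exact: ltW | rewrite e ltxx in h].
Qed.

Lemma notin_left_of X p q y : y \in X -> y \notin left_of X (p, q) ->
  cross p q y <= 0 /\ (cross p q y = 0 -> along p q y <= 0).
Proof.
rewrite inE => -> /=; rewrite negb_or -leNgt negb_and => /andP[-> h].
by split=> // e; move: h; rewrite e eqxx -leNgt.
Qed.

(** Expand [y - p] in the orthogonal basis formed by [q - p] and its rotation by a right angle; the
    second coefficient is a multiple of [cross p q y]. *)
Lemma cross_eq0 p q y : p != q -> cross p q y = 0 ->
  exists s, [/\ cx y = cx p + s * (cx q - cx p),
                cy y = cy p + s * (cy q - cy p) & along p q y = s * along p q q].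
Proof.
move=> npq; have d0 := along_gt0 npq; rewrite /cross => c0.
have N : along p q q != 0 by rewrite gt_eqF.
exists (along p q y / along p q q); split; last by rewrite divfK.
- apply: (mulIf N); rewrite mulrDl mulrAC divfK //.
  suff -> : cx y * along p q q = cx p * along p q q + along p q y * (cx q - cx p)
     - (cy q - cy p) * ((cx q - cx p) * (cy y - cy p)
                        - (cy q - cy p) * (cx y - cx p)).
    by rewrite c0; ring.
  by rewrite /along; ring.
- apply: (mulIf N); rewrite mulrDl mulrAC divfK //.
  suff -> : cy y * along p q q = cy p * along p q q + along p q y * (cy q - cy p)
     + (cx q - cx p) * ((cx q - cx p) * (cy y - cy p)
                        - (cy q - cy p) * (cx y - cx p)).
    by rewrite c0; ring.
  by rewrite /along; ring.
Qed.

(** The determinant of [q - p] and [q' - p'] is nonnegative by the first description of the common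
    set and nonpositive by the second. Hence all four points are collinear, and adjacency leaves
    only one position for [p'] and [q'] on the line. *)
Lemma left_of_inj X : {in adjacent_pairs X &, injective (left_of X)}.
Proof.
move=> [p q] [p' q'] uA vA E.
have [qp' pp'] : q' \in left_of X (p, q) /\ p' \notin left_of X (p, q).
  by rewrite E left_of_head // left_of_tail.
have [qp pp] : q \in left_of X (p', q') /\ p \notin left_of X (p', q').
  by rewrite -E left_of_head // left_of_tail.
case/adjacent_pairsP: uA => pX qX npq adj.
case/adjacent_pairsP: vA => pX' qX' npq' adj'.
have [c1 a1] := in_left_of qp'; have [c2 a2] := notin_left_of pX' pp'.
have [c3 a3] := in_left_of qp; have [c4 a4] := notin_left_of pX pp.
have e1 : cross p q q' - cross p q p' =
          - (cross p' q' q - cross p' q' p) by rewrite /cross; ring.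
have z1 : cross p q q' = 0 by lra.
have z2 : cross p q p' = 0 by lra.
have z3 : cross p' q' q = 0 by lra.
have z4 : cross p' q' p = 0 by lra.
have d0 := along_gt0 npq.
have [s [sx sy sa]] := cross_eq0 npq z1.
have [r [rx ry ra]] := cross_eq0 npq z2.
have := a1 z1; have := a2 z2; rewrite sa ra => r0 s0.
have {r0} r0 : r <= 0 by rewrite pmulr_lle0 in r0.
have {s0} s0 : 0 < s by rewrite pmulr_lgt0 in s0.
have ap : along p' q' p = (s - r) * (- r) * along p q q.
  by rewrite /along sx sy rx ry; ring.
have aq : along p' q' q = (s - r) * (1 - r) * along p q q.
  by rewrite /along sx sy rx ry; ring.
have ad : along p' q' q' = (s - r) * (s - r) * along p q q.
  by rewrite /along sx sy rx ry; ring.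
have sr : 0 < s - r by lra.
(* On the line, [p'] and [q'] have parameters [r <= 0 < s], while [p] and [q] have 0 and 1. Since
   [p] is outside the common set, [r >= 0]; that neither head is between the other two ends gives
   [s = 1]. *)
have {r0} r0 : r = 0.
  have := a4 z4; rewrite ap pmulr_lle0 // pmulr_rle0 //; lra.
have s1 : 1 <= s.
  have := adj q' qX'; rewrite /between z1 eqxx /= sa pmulr_lgt0 // s0 /=.
  by rewrite -leNgt ler_pMl.
have {s1} s1 : s = 1.
  have := adj' q qX; rewrite /between z3 eqxx /= (a3 z3) /= -leNgt ad aq.
  by rewrite ler_pM2r // ler_pM2l //; lra.
congr (_, _); apply: cxyI.
- by rewrite rx r0; ring.
- by rewrite ry r0; ring.
- by rewrite sx s1; ring.
- by rewrite sy s1; ring.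
Qed.

(* Among the differences from a point outside [A] to a point of [A], which lie
   in an open half plane, take the clockwise-most direction and then the shortest
   vector: this is the segment of an inner common tangent joining the two sides. *)
Lemma left_of_surj X A z0 w0 : separable X A ->
  z0 \in X -> z0 \notin A -> w0 \in A ->
  exists2 u, u \in adjacent_pairs X & A = left_of X u.
Proof.
case/separableP => /subsetP AX [a [b [c sepA]]] z0X z0A w0A.
(* [h] and [k] are, up to scale, the coordinates of [u.2 - u.1] along the gradient [(a, b)] and its
   counterclockwise normal. So [k / h] is the slope, and [h] compares lengths at equal slope. *)
pose h (u : T * T) := a * (cx u.2 - cx u.1) + b * (cy u.2 - cy u.1).
pose k (u : T * T) := a * (cy u.2 - cy u.1) - b * (cx u.2 - cx u.1).
pose P (u : T * T) := [&& u.1 \in X, u.1 \notin A & u.2 \in A].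
have hP u : P u -> 0 < h u.
  case/and3P => zX zA wA; have := sepA _ zX; have := sepA _ (AX _ wA).
  by rewrite /separates wA (negPf zA) /aff /h => ? ?; lra.
have P0 : P (z0, w0) by rewrite /P /= z0X z0A w0A.
case: (arg_minP (fun u => k u / h u) P0) => u1 Pu1 min1.
have Q1 : P u1 && (k u1 / h u1 == k u1 / h u1) by rewrite Pu1 eqxx.
case: (arg_minP (P := fun u => P u && (k u / h u == k u1 / h u1)) h Q1).
move=> [p q] /andP[Pu /eqP Eu] min2.
have hu := hP _ Pu.
have slope v : P v -> k (p, q) * h v <= k v * h (p, q).
  move=> Pv; have := min1 v Pv; rewrite -Eu ler_pdivlMr ?hP //.
  by rewrite mulrAC ler_pdivrMr.
have short v : P v -> k (p, q) * h v = k v * h (p, q) -> h (p, q) <= h v.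
  move=> Pv E; apply: min2; rewrite Pv /= -Eu.
  by rewrite eqr_div ?E // lt0r_neq0 // hP.
case/and3P: (Pu) => /= pX pA qA.
have npq : p != q by apply: contraNneq pA => ->.
have ab : 0 < a ^+ 2 + b ^+ 2.
  rewrite lt_neqAle addr_ge0 ?sqr_ge0 // andbT eq_sym paddr_eq0 ?sqr_ge0 //.
  apply/negP; rewrite !sqrf_eq0 => /andP[/eqP ea /eqP eb].
  by move: hu; rewrite /h ea eb !mul0r addr0 ltxx.
(* This identity turns comparison of slopes into comparison of the values of [cross p q]. *)
have det y z : (a ^+ 2 + b ^+ 2) * (cross p q z - cross p q y)
    = k (y, z) * h (p, q) - k (p, q) * h (y, z).
  by rewrite /cross /k /h /=; ring.
have crossP y z : P (y, z) -> cross p q y <= cross p q z.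
  by move=> /slope; rewrite -subr_ge0 -det pmulr_rge0 // subr_ge0.
have shortP y z : P (y, z) -> cross p q y = cross p q z -> h (p, q) <= h (y, z).
  move=> Pv E; apply: short Pv _.
  by have := det y z; rewrite E subrr mulr0; lra.
have cp : cross p q p = 0 by rewrite /cross; ring.
have cq : cross p q q = 0 by rewrite /cross; ring.
have d0 := along_gt0 npq.
(* Points of [A] are tested through the pair [(p, y)], points outside it through [(y, q)]:
   extremality of the slope gives the side, and minimal length settles the points on the line. *)
have inA y : y \in A -> 0 <= cross p q y /\
    (cross p q y = 0 -> along p q q <= along p q y).
  move=> yA; have Pv : P (p, y) by rewrite /P /= pX pA yA.
  split=> [|c0]; first by rewrite -cp crossP.
  have [s [sx sy ->]] := cross_eq0 npq c0.
  have := shortP _ _ Pv; rewrite cp c0 => /(_ erefl).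
  rewrite (_ : h (p, y) = s * h (p, q)); last by rewrite /h /= sx sy; ring.
  by rewrite ler_pMl // ler_pMl.
have outA y : y \in X -> y \notin A -> cross p q y <= 0 /\
    (cross p q y = 0 -> along p q y <= 0).
  move=> yX yA; have Pv : P (y, q) by rewrite /P /= yX yA qA.
  split=> [|c0]; first by rewrite -cq crossP.
  have [s [sx sy ->]] := cross_eq0 npq c0.
  have := shortP _ _ Pv; rewrite cq c0 => /(_ erefl).
  rewrite (_ : h (y, q) = (1 - s) * h (p, q)); last by rewrite /h /= sx sy; ring.
  by rewrite ler_pMl // pmulr_lle0 // => ?; lra.
exists (p, q).
  apply/adjacent_pairsP; split => //; first exact: AX.
  move=> y yX; apply/negP => /andP[/eqP c0 /andP[l1 l2]].
  have [yA|yA] := boolP (y \in A).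
    by have [_ /(_ c0)] := inA _ yA; lra.
  by have [_ /(_ c0)] := outA _ yX yA; lra.
apply/setP => y; rewrite inE.
have [yA|yA] := boolP (y \in A).
  rewrite AX //=; have [] := inA _ yA; rewrite le_eqVlt => /orP[/eqP e|->] //.
  by rewrite -e => /(_ erefl) l; rewrite eqxx (lt_le_trans d0 l) orbT.
have [yX|] //= := boolP (y \in X).
have [c1 c2] := outA _ yX yA; apply/esym/negbTE; rewrite negb_or -leNgt c1 /=.
by apply/negP => /andP[/eqP /c2]; lra.
Qed.

Definition separables X := [set A | separable X A].

(** The two extra sets are the empty set and [X], distinct as [X] is nonempty. Neither is a
    [left_of], which contains its head and misses its tail. *)
Lemma card_separables X : X != set0 ->
  #|separables X| = #|adjacent_pairs X|.+2.
Proof.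
case/set0Pn => x0 x0X.
rewrite -(card_in_imset (@left_of_inj X)).
have XE : set0 != X by apply/eqP => E; rewrite -E inE in x0X.
have -> : separables X = [set set0; X] :|: left_of X @: adjacent_pairs X.
  apply/setP => A; rewrite !inE; apply/idP/idP => [sA|].
    have [//|[w0 w0A]] := set_0Vmem A; first by move=> ->; rewrite eqxx.
    have [->|NA] := eqVneq A X; first by rewrite orbT.
    have AX : A \subset X by case/separableP: sA.
    have : ~~ (X \subset A) by apply: contraNN NA; rewrite eqEsubset AX.
    case/subsetPn => z0 z0X z0A.
    have [u uX ->] := left_of_surj sA z0X z0A w0A.
    by rewrite imset_f ?orbT.
  case/orP => [/orP[/eqP->|/eqP->]|/imsetP[[p q] uX ->]].
  - apply/separableP; split; first exact: sub0set.
    by exists 0, 0, (-1) => y _; rewrite /separates inE /aff; lra.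
  - apply/separableP; split => //.
    by exists 0, 0, 1 => y yX; rewrite /separates yX /aff; lra.
  - exact: left_of_separable.
rewrite cardsU cards2 XE.
rewrite (_ : _ :&: _ = set0) ?cards0 ?subn0 //.
apply/setP => A; rewrite !inE; apply/negP => /andP[E /imsetP[[p q] uX Au]].
move: E; rewrite Au => /orP[/eqP E|/eqP E].
  by have := left_of_head uX; rewrite E inE.
by have := left_of_tail X p q; rewrite E; case/adjacent_pairsP: uX => ->.
Qed.

(** * Deleting a point *)

(** A line that separates the other points has [x] on one of its sides; if it passes through [x], a
    small shift puts [x] on the negative side. *)
Lemma separableD1 X A x : x \in X ->
  separable (X :\ x) A = (x \notin A) && (separable X A || separable X (x |: A)).
Proof.
move=> xX; apply/idP/andP.
  case/separableP => AX [a [b [c sepA]]].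
  have xA : x \notin A by apply/negP => /(subsetP AX); rewrite !inE eqxx.
  split=> //.
  have [sA|sA] := leP (aff a b c x) 0; last first.
    apply/orP; right; apply/separableP; split.
      by rewrite subUset sub1set xX (subset_trans AX) // subD1set.
    exists a, b, c => y yX; rewrite /separates !inE.
    have [->//|nyx] := eqVneq y x.
    by have := sepA y; rewrite !inE nyx yX => /(_ isT).
  apply/orP; left; apply/separableP.
  split; first by rewrite (subset_trans AX) // subD1set.
  move: sA; rewrite le_eqVlt => /orP[/eqP sA|sA]; last first.
    exists a, b, c => y yX; rewrite /separates.
    have [->|nyx] := eqVneq y x; first by rewrite (negPf xA).
    by have := sepA y; rewrite !inE nyx yX => /(_ isT).
  have sep' y : y \in X -> y != x -> separates (aff a b c) A y.
    by move=> yX nyx; apply: sepA; rewrite !inE nyx.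
  have [y yX f0|y yX f0|e e0 He] := @separates_perturb X A (aff a b c) (fun=> -1).
  - by apply: sep' => //; apply: contraNneq f0 => ->; rewrite sA.
  - have [->|nyx] := eqVneq y x; first by rewrite /separates (negPf xA); lra.
    by have := sep' y yX nyx; rewrite /separates f0 ltxx; case: ifP.
  exists a, b, (c - e) => y yX; have := He y yX; rewrite /separates /aff.
  by case: ifP => _ ?; lra.
move=> [xA sA].
have [B [BX [a [b [c sepB]]] BA]] : exists B : {set T}, [/\ B \subset X,
    exists a b c : R, forall y, y \in X -> separates (aff a b c) B y
    & forall y, y != x -> (y \in B) = (y \in A)].
  case/orP: sA => /separableP[BX H].
    by exists A; split.
  by exists (x |: A); split => // y nyx; rewrite !inE (negPf nyx).
apply/separableP; split.
  apply/subsetP => y yA; have nyx : y != x by apply: contraNneq xA => <-.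
  by rewrite !inE nyx (subsetP BX) // BA.
exists a, b, c => y; rewrite !inE => /andP[nyx yX].
by have := sepB y yX; rewrite /separates BA.
Qed.

Definition flippable X x :=
  [set A in separables X | (x \notin A) && separable X (x |: A)].

(** Inclusion-exclusion: [U] and [V] have [flippable X x] as intersection and the separable subsets
    of [X :\ x] as union. Adding [x] matches [V] with the separable sets that contain [x], so the
    two cardinalities sum to the total. *)
Lemma card_flippable X x : x \in X ->
  (#|flippable X x| + #|separables (X :\ x)|)%N = #|separables X|.
Proof.
move=> xX.
pose U := [set A in separables X | x \notin A].
pose V := [set A : {set T} | (x \notin A) && separable X (x |: A)].
have -> : flippable X x = U :&: V.
  by apply/setP => A; rewrite !inE; case: (x \in A) => /=; rewrite ?andbF ?andbT.
have -> : separables (X :\ x) = U :|: V.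
  apply/setP => A; rewrite !inE separableD1 //.
  by case: (x \in A) => /=; rewrite ?andbF ?andbT.
rewrite addnC cardsUI addnC.
have -> : #|V| = #|[set A in separables X | x \in A]|.
  rewrite -(@card_in_imset _ _ (fun A => x |: A) V).
    apply: eq_card => A; rewrite !inE; apply/imsetP/andP.
      by case=> B; rewrite inE => /andP[xB sB] ->; rewrite sB !inE eqxx.
    case=> sA xA; exists (A :\ x); last by rewrite setD1K.
    by rewrite !inE eqxx setD1K.
  move=> A B; rewrite !inE => /andP[xA _] /andP[xB _] E.
  by rewrite -(setU1K xA) E setU1K.
have -> : U = separables X :\: [set A : {set T} | x \in A].
  by apply/setP => A; rewrite !inE andbC.
rewrite (_ : [set A in separables X | x \in A] =
  separables X :&: [set A : {set T} | x \in A]).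
  by rewrite cardsID.
by apply/setP => A; rewrite !inE.
Qed.

(** For [x] in [X], these are the pairs with [x] as the only point of [X] strictly between them; [x]
    need not be the metric midpoint. *)
Definition midpoint_pairs X x : {set T * T} :=
  [set u in setX X X | [forall y in X, between u.1 u.2 y == (y == x)]].

Lemma between_tail p q : between p q p = false.
Proof.
by rewrite /between (_ : along p q p = 0) ?ltxx ?andbF // /along; ring.
Qed.

Lemma between_head p q : between p q q = false.
Proof. by rewrite /between ltxx !andbF. Qed.

Lemma between_neq p q x : between p q x -> [/\ p != q, x != p & x != q].
Proof.
move=> b; split.
- apply: contraTneq b => ->; rewrite /between /along.
  by rewrite !subrr !mul0r addr0 ltxx /= andbF.
- by apply: contraTneq b => ->; rewrite between_tail.
- by apply: contraTneq b => ->; rewrite between_head.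
Qed.

(** Deleting [x] destroys the adjacent pairs that have [x] as an end and creates those that only [x]
    was blocking. *)
Lemma adjacent_pairsD1 X x : x \in X ->
  adjacent_pairs (X :\ x) =
  adjacent_pairs X :\: [set u | (u.1 == x) || (u.2 == x)] :|: midpoint_pairs X x.
Proof.
move=> xX; apply/setP => -[p q]; rewrite in_setU in_setD.
have -> : ((p, q) \in midpoint_pairs X x) =
    [&& p \in X, q \in X & [forall y in X, between p q y == (y == x)]].
  by rewrite inE in_setX andbA.
have -> : ((p, q) \in [set u | (u.1 == x) || (u.2 == x)]) = (p == x) || (q == x).
  by rewrite inE.
rewrite negb_or.
apply/idP/orP.
  case/adjacent_pairsP => /setD1P[px pX] /setD1P[qx qX] npq adj.
  have [bx|bx] := boolP (between p q x); [right|left].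
    rewrite pX qX /=; apply/forall_inP => y yX.
    have [->|nyx] := eqVneq y x; first by rewrite bx.
    by rewrite (negPf (adj y _)) // !inE nyx.
  rewrite px qx andTb; apply/adjacent_pairsP; split => // y yX.
  have [->//|nyx] := eqVneq y x.
  by apply: adj; rewrite !inE nyx.
case=> [/andP[/andP[px qx]] /adjacent_pairsP[pX qX npq adj]|].
  apply/adjacent_pairsP; rewrite !inE px qx pX qX; split => // y.
  by rewrite !inE => /andP[_]; apply: adj.
case/and3P => pX qX /forall_inP H.
have /between_neq[npq xp xq] : between p q x by rewrite (eqP (H x xX)).
apply/adjacent_pairsP; rewrite !inE pX qX ![_ == x]eq_sym xp xq; split=> // y.
by rewrite !inE => /andP[nyx yX]; rewrite (eqP (H y yX)).
Qed.

Lemma card_adjacent_pairsD1 X x : x \in X ->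
  (#|adjacent_pairs (X :\ x)| + #|[set u in adjacent_pairs X | u.1 == x]|
     + #|[set u in adjacent_pairs X | u.2 == x]|)%N
  = (#|adjacent_pairs X| + #|midpoint_pairs X x|)%N.
Proof.
move=> xX; rewrite adjacent_pairsD1 // cardsU (_ : _ :&: midpoint_pairs X x = set0).
  rewrite cards0 subn0 -(cardsID [set u | (u.1 == x) || (u.2 == x)] (adjacent_pairs X)).
  rewrite (_ : _ :&: [set u | _] = [set u in adjacent_pairs X | u.1 == x]
      :|: [set u in adjacent_pairs X | u.2 == x]); last first.
    by apply/setP => u; rewrite !inE andb_orr.
  rewrite cardsU (_ : [set u in adjacent_pairs X | u.1 == x] :&: _ = set0).
    by rewrite cards0 subn0 [RHS](ACl (3 * 4 * 1 * 2)).
  apply/setP => -[p q]; rewrite 2!inE [_ \in [set u in _ | u.2 == x]]inE in_set0 /=.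
  apply/negP => /andP[/andP[/adjacent_pairsP[_ _ npq _] /eqP e1] /andP[_ /eqP e2]].
  by rewrite e1 e2 eqxx in npq.
apply/setP => -[p q]; rewrite 2!inE in_set0.
apply/negP => /andP[/andP[_ /adjacent_pairsP[_ _ _ adj]]].
rewrite inE => /andP[_ /forall_inP /(_ x xX)].
by rewrite eqxx eqb_id; apply/negP/adj.
Qed.

(** Two points at least are required so that [X :\ x] is nonempty and the summand 2 of
    [card_separables] cancels. Summed over [x], each adjacent pair is met twice, once at each
    end. *)
Lemma sum_card_flippable X : (1 < #|X|)%N ->
  (\sum_(x in X) #|flippable X x| + \sum_(x in X) #|midpoint_pairs X x|)%N
  = (2 * #|adjacent_pairs X|)%N.
Proof.
move=> X1.
have fib (f : T * T -> T) : {in adjacent_pairs X, forall u, f u \in X} ->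
    (\sum_(x in X) #|[set u in adjacent_pairs X | f u == x]|)%N
    = #|adjacent_pairs X|.
  move=> fX; rewrite -sum1_card (partition_big f (mem X)) //=.
  apply: eq_bigr => x _; rewrite -sum1_card.
  by apply: eq_bigl => u; rewrite !inE.
rewrite -big_split /= mulSn mul1n.
transitivity (\sum_(x in X) (#|[set u in adjacent_pairs X | u.1 == x]|
   + #|[set u in adjacent_pairs X | u.2 == x]|))%N; last first.
  by rewrite big_split /= !fib // => -[p q] /adjacent_pairsP[].
apply: eq_bigr => x xX.
have X0 : X != set0 by apply/set0Pn; exists x.
have X'0 : X :\ x != set0.
  by rewrite -card_gt0; move: X1; rewrite (cardsD1 x) xX.
have arith (a b c d e f : nat) :
  (a + b.+2 = c.+2 -> b + d + e = c + f -> a + f = d + e)%N by lia.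
apply: arith (card_adjacent_pairsD1 xX).
by rewrite -!card_separables // card_flippable.
Qed.

(** * Moving between separable sets by flipping points *)

(** Lowering the constant term slightly makes the zeros negative and leaves the other signs
    unchanged. *)
Lemma separable_sign X A a b c : A \subset X ->
  (forall y, y \in X -> (y \in A) = (0 < aff a b c y)) -> separable X A.
Proof.
move=> AX sepA; apply/separableP; split=> //.
have [y yX f0|y yX f0|e e0 He] := @separates_perturb X A (aff a b c) (fun=> -1).
- by rewrite /separates sepA //; case: ltP => // h; rewrite lt_neqAle f0.
- by rewrite /separates sepA // f0 ltxx; lra.
exists a, b, (c - e) => y yX; have := He y yX; rewrite /separates /aff.
by case: ifP => _ ?; lra.
Qed.

Definition flip x A : {set T} := [set y | (y \in A) (+) (y == x)].

(** Genericity says that the pencil spanned by the two functionals does not vanish at [x] and [y]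
    simultaneously. *)
Lemma separable_generic X A B x y : separable X A -> separable X B ->
  x \in X -> x != y ->
  exists a b c a' b' c', [/\ forall z, z \in X -> separates (aff a b c) A z,
    forall z, z \in X -> separates (aff a' b' c') B z &
    aff a b c x * aff a' b' c' y != aff a b c y * aff a' b' c' x].
Proof.
case/separableP=> AX [a [b [c sepA]]] /separableP[BX [a' [b' [c' sepB]]]] xX nxy.
have [E|N] := eqVneq (aff a b c x * aff a' b' c' y) (aff a b c y * aff a' b' c' x);
  last by exists a, b, c, a', b', c'.
(* The perturbation [along x y] vanishes at [x] and not at [y]; since the first functional is
   nonzero at [x], it breaks the equality. *)
have [z zX f0|z zX f0|e e0 He] := @separates_perturb X B (aff a' b' c') (along x y).
- exact: sepB.
- by have := sepB z zX; rewrite /separates f0 ltxx; case: ifP.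
pose dx := cx y - cx x; pose dy := cy y - cy x.
pose c2 := c' + e * - (dx * cx x + dy * cy x).
have gE z : aff (a' + e * dx) (b' + e * dy) c2 z = aff a' b' c' z + e * along x y z.
  by rewrite /aff /along /c2 /dx /dy; ring.
exists a, b, c, (a' + e * dx), (b' + e * dy), c2; split=> //.
  by move=> z zX; have := He z zX; rewrite /separates gE.
rewrite !gE (_ : along x y x = 0); last by rewrite /along; ring.
rewrite mulr0 addr0 mulrDr E -subr_eq0 addrAC subrr add0r.
rewrite !mulf_neq0 ?(lt0r_neq0 e0) ?(lt0r_neq0 (along_gt0 nxy)) //.
have := sepA x xX; rewrite /separates; case: ifP => _ h.
  by rewrite gt_eqF.
by rewrite lt_eqF.
Qed.

(* The mediant combination of the two separating functionals changes sign, with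
   respect to the first one, at exactly one of the points [x] and [y]. *)
Lemma separable_mediant X A B x y : separable X A -> separable X B ->
  x \in X -> y \in X -> x != y ->
  (x \in A) != (x \in B) -> (y \in A) != (y \in B) ->
  exists C, [/\ separable X C,
    forall z, z \in X -> (z \in A) = (z \in B) -> (z \in C) = (z \in A) &
    ((x \in C) == (x \in A)) = ((y \in C) != (y \in A))].
Proof.
move=> sA sB xX yX nxy xAB yAB.
have [a [b [c [a' [b' [c' [sepA sepB N]]]]]]] := separable_generic sA sB xX nxy.
set f := aff a b c in sepA N; set g := aff a' b' c' in sepB N.
(* The ratio [be / al] is the mediant of [|f x| / |g x|] and [|f y| / |g y|], which differ by [N],
   hence lies strictly between them. As [f] and [g] have opposite signs at both points, [k] takes
   the sign of [f] at one and that of [g] at the other. *)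
pose al := `|g x| + `|g y|; pose be := `|f x| + `|f y|.
pose k := aff (al * a + be * a') (al * b + be * b') (al * c + be * c').
have kE z : k z = al * f z + be * g z by rewrite /k /f /g /aff; ring.
have sgn (h : T -> R) (D : {set T}) z : separates h D z -> h z != 0.
  by rewrite /separates; case: ifP => _ ?; [rewrite gt_eqF|rewrite lt_eqF].
have al0 : 0 < al.
  by rewrite addr_gt0 // normr_gt0; [exact: sgn (sepB _ xX)|exact: sgn (sepB _ yX)].
have be0 : 0 < be.
  by rewrite addr_gt0 // normr_gt0; [exact: sgn (sepA _ xX)|exact: sgn (sepA _ yX)].
exists [set z in X | 0 < k z]; split.
- apply: separable_sign (_ : forall z, _ -> _ = (0 < k z)).
    by apply/subsetP => z; rewrite inE => /andP[].
  by move=> z zX; rewrite inE zX.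
- move=> z zX E; rewrite inE zX /= kE.
  have := sepA z zX; have := sepB z zX; rewrite /separates -E.
  case: ifP => _ h1 h2; first by rewrite addr_gt0 // mulr_gt0.
  have h3 : al * f z < 0 by rewrite pmulr_rlt0.
  have h4 : be * g z < 0 by rewrite pmulr_rlt0.
  by apply/negbTE; rewrite -leNgt; lra.
have kx : k x = al * f x + be * g x by exact: kE.
have ky : k y = al * f y + be * g y by exact: kE.
rewrite !inE xX yX /=.
move: kx ky; rewrite /al /be.
have := sepA x xX; have := sepA y yX; have := sepB x xX; have := sepB y yX.
rewrite /separates.
move: xAB yAB N; case: (x \in A); case: (x \in B) => //= _;
  case: (y \in A); case: (y \in B) => //= _;
  rewrite neq_lt => /orP[] h gy gx fy fx;
  rewrite ?(gtr0_norm gy) ?(gtr0_norm gx) ?(gtr0_norm fy) ?(gtr0_norm fx)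
    ?(ltr0_norm gy) ?(ltr0_norm gx) ?(ltr0_norm fy) ?(ltr0_norm fx) => kx ky;
  case: ltP => h1; case: ltP => h2 //; exfalso; lra.
Qed.

(** Induction on the number of points where [A] and [B] differ. With a single one, flipping it turns
    [A] into [B]; with two, the mediant set [C] still differs from [A], at fewer points and only
    where [B] does. *)
Lemma separable_step X A B : separable X A -> separable X B -> A != B ->
  exists2 x, (x \in A) != (x \in B) & separable X (flip x A).
Proof.
move=> sA; pose D (C : {set T}) := [set z | (z \in A) != (z \in C)].
have [k] := ubnP #|D B|; elim: k B => // k IH B kB sB nAB.
have outD C z : separable X C -> z \in D C -> z \in X.
  case/separableP=> /subsetP CX _; case/separableP: (sA) => /subsetP AX _.
  rewrite inE; apply: contraR => zX.
  by rewrite (contraNF (AX z) zX) (contraNF (CX z) zX).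
have [x xD] : exists x, x \in D B.
  apply/set0Pn; apply: contraNneq nAB => D0; apply/eqP/setP => z.
  by apply/eqP; apply: contraFT (in_set0 z) => h; rewrite -D0 inE.
have [D1|[y]] := set_0Vmem (D B :\ x).
  exists x; first by rewrite inE in xD.
  rewrite (_ : flip x A = B) //; apply/setP => z; rewrite inE.
  have [->|nzx] := eqVneq z x.
    by move: xD; rewrite inE; case: (x \in A); case: (x \in B).
  rewrite addbF; apply/eqP; apply: contraFT (in_set0 z) => h.
  by rewrite -D1 !inE nzx.
rewrite in_setD1 => /andP[nyx yD].
have xX := outD _ _ sB xD; have yX := outD _ _ sB yD.
have nxy : x != y by rewrite eq_sym.
have xAB : (x \in A) != (x \in B) by rewrite inE in xD.
have yAB : (y \in A) != (y \in B) by rewrite inE in yD.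
have [C [sC agree xy]] := separable_mediant sA sB xX yX nxy xAB yAB.
have sub : D C \subset D B.
  apply/subsetP => z zC; have zX := outD _ _ sC zC; move: zC; rewrite !inE.
  by apply: contraNN => /eqP E; rewrite agree.
(* Exactly one of [x] and [y] stays in the difference, so [D C] is both nonempty and strictly
   smaller than [D B]. *)
have xE : (x \in D C) = (y \notin D C).
  by rewrite !inE negbK ![(_ \in A) == (_ \in C)]eq_sym xy negbK.
have ltC : (#|D C| < k)%N.
  rewrite -ltnS; apply: leq_trans kB; rewrite ltnS; apply: proper_card.
  rewrite properE sub; apply/subsetPn.
  by have [xC|xC] := boolP (x \in D C); [exists y; rewrite // -xE|exists x].
have nAC : A != C.
  have : D C != set0.
    apply/set0Pn; have [xC|] := boolP (x \in D C); first by exists x.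
    by rewrite xE negbK; exists y.
  by apply: contraNneq => <-; apply/eqP/setP => z; rewrite !inE eqxx.
have [z zC sz] := IH C ltC sC nAC.
exists z => //; have : z \in D C by rewrite inE.
by move/(subsetP sub); rewrite inE.
Qed.

(** * Double counting of flips and of blocked pairs *)

Lemma flipK x : involutive (flip x).
Proof. by move=> A; apply/setP => y; rewrite !inE addbK. Qed.

(** For fixed [x], the involution [flip x] exchanges the sets that contain [x] with those that do
    not; the latter form [flippable X x]. *)
Lemma sum_card_flips X :
  (\sum_(A in separables X) #|[set x in X | separable X (flip x A)]|)%N
  = (2 * \sum_(x in X) #|flippable X x|)%N.
Proof.
under eq_bigr do rewrite -sum1_card big_mkcond.
rewrite exchange_big /= (bigID (mem X)) /= [X in (_ + X)%N]big1 ?addn0; last first.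
  by move=> x /negPf xX; rewrite big1 // => A _; rewrite inE xX.
rewrite big_distrr /=; apply: eq_bigr => x xX.
rewrite -big_mkcondr sum1dep_card.
have fE (A : {set T}) : x \notin A -> flip x A = x |: A.
  move=> xA; apply/setP => y; rewrite !inE.
  by have [->|_] := eqVneq y x; rewrite ?(negPf xA) ?addbF.
set F := [set _ | _].
rewrite -(cardsID [set A : {set T} | x \in A] F) mul2n -addnn.
have -> : F :\: [set A : {set T} | x \in A] = flippable X x.
  apply/setP => A; rewrite !inE xX /= [RHS]andbCA.
  by have [//|xA] := boolP (x \in A); rewrite /= fE.
congr (_ + _)%N; rewrite -(card_imset (flippable X x) (inv_inj (flipK x))).
apply: eq_card => A; rewrite !inE xX /=; apply/idP/imsetP.
  case/andP => /andP[sA sfA] xA; exists (flip x A); last by rewrite flipK.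
  have xfA : x \notin flip x A by rewrite inE xA eqxx.
  by rewrite inE [_ \in separables X]inE sfA xfA -fE // flipK sA.
case=> B; rewrite !inE => /and3P[sB xB sxB] ->.
by rewrite flipK sB fE // sxB !inE eqxx.
Qed.

Lemma sum_card_midpoint_pairs X :
  (\sum_(x in X) #|midpoint_pairs X x|)%N
  = #|[set u in setX X X | #|[set y in X | between u.1 u.2 y]| == 1%N]|.
Proof.
under eq_bigr do rewrite -sum1_card big_mkcond.
rewrite exchange_big /= -sum1_card [RHS]big_mkcond /=; apply: eq_bigr => u _.
rewrite inE; case: (boolP (u \in setX X X)) => uX /=; last first.
  by rewrite big1 // => x _; rewrite inE (negPf uX).
have mE x : x \in X ->
    (u \in midpoint_pairs X x) = ([set y in X | between u.1 u.2 y] == [set x]).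
  move=> xX; rewrite inE uX /=; apply/forall_inP/eqP => [H|H y yX].
    apply/setP => y; rewrite !inE; have [yX|yX] := boolP (y \in X).
      by rewrite (eqP (H y yX)).
    by apply/esym/negbTE; apply: contraNneq yX => ->.
  by have /setP/(_ y) := H; rewrite !inE yX /= => ->.
rewrite -big_mkcondr /=.
case: cards1P => [[z Ez]|nz].
  have zX : z \in X by have /setP/(_ z) := Ez; rewrite !inE eqxx => /andP[].
  rewrite (big_pred1 z) // => x /=.
  have [xX|xX] := boolP (x \in X); last first.
    by apply/esym/negbTE; apply: contraNneq xX => ->.
  by rewrite mE // Ez eq_sym; apply/eqP/eqP => [/set1_inj|->].
rewrite big_pred0 // => x; apply/negP => /andP[xX]; rewrite mE // => /eqP E.
by apply: nz; exists x.
Qed.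

End Points.

(** * Grid points and greatest common divisors *)

Lemma card_differences (m : nat) (i : int) : i \in int_range m ->
  \sum_(p < m) \sum_(q < m) ((q%:Z - p%:Z == i)%R%:R : int) = m%:Z - `|i|.
Proof.
rewrite mem_int_range => /andP[i1 i2].
have inner (p : 'I_m) : \sum_(q < m) ((q%:Z - p%:Z == i)%R%:R : int)
    = (0 <= p%:Z + i < m%:Z)%R%:R.
  have [h|h] := boolP (0 <= p%:Z + i < m%:Z); last first.
    by rewrite big1 // => q _; have := ltn_ord q; case: eqP => //; lia.
  have ltm : (absz (p%:Z + i)%R < m)%N by lia.
  rewrite (bigD1 (Ordinal ltm)) //= big1 ?addr0; first by case: eqP => //; lia.
  by move=> q /eqP nq; case: eqP => // E; case: nq; apply: val_inj => /=; lia.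
under eq_bigr do rewrite inner.
(* The admissible [p] form the intersection of [[0, m)] and [[-i, m - i)], of length [m - |i|]. Both
   bounds are nonnegative, so [absz] does not change them. *)
pose lo := absz (Num.max 0 (- i)); pose hi := absz (Num.min m%:Z (m%:Z - i)).
have -> : \sum_(p < m) ((0 <= p%:Z + i < m%:Z)%R%:R : int)
    = \sum_(p < m) ((lo <= p < hi)%N)%:R.
  apply: eq_bigr => p _; congr (nat_of_bool _)%:R; have := ltn_ord p.
  by rewrite /lo /hi; lia.
rewrite -natr_sum -(big_mkord xpredT (fun p => (lo <= p < hi)%N : nat)).
rewrite -big_mkcond /=.
have him : (hi <= m)%N by rewrite /hi; lia.
rewrite (_ : \sum_(0 <= p < m | (lo <= p < hi)%N) 1 = \sum_(lo <= p < hi) 1)%N.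
  by rewrite sum_nat_const_nat muln1 natz /lo /hi; lia.
rewrite [RHS](big_nat_widen _ _ m) // [RHS](big_nat_widenl _ 0) //.
by apply: eq_bigl => p /=; rewrite andbC.
Qed.

Lemma sum_differences (m : nat) (F : int -> int) :
  \sum_(p < m) \sum_(q < m) F (q%:Z - p%:Z)
  = \sum_(i <- int_range m) (m%:Z - `|i|) * F i.
Proof.
transitivity (\sum_(i <- int_range m) \sum_(p < m) \sum_(q < m)
    (q%:Z - p%:Z == i)%R%:R * F i); last first.
  rewrite big_seq [RHS]big_seq; apply: eq_bigr => i ir.
  rewrite -card_differences // mulr_suml; apply: eq_bigr => p _.
  by rewrite mulr_suml.
rewrite [RHS]exchange_big /=; apply: eq_bigr => p _.
rewrite [RHS]exchange_big /=; apply: eq_bigr => q _.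
rewrite [RHS](bigD1_seq (q%:Z - p%:Z)) ?int_range_uniq //=; last first.
  by rewrite mem_int_range; have := ltn_ord p; have := ltn_ord q; lia.
rewrite eqxx mul1r big1 ?addr0 // => i ni.
by rewrite eq_sym (negPf ni) mul0r.
Qed.

(** The value is 0 exactly when the two points coincide. *)
Definition grid_gcd (m n : nat) (u : ('I_m * 'I_n) * ('I_m * 'I_n)) : int :=
  gcdz (u.2.1%:Z - u.1.1%:Z) (u.2.2%:Z - u.1.2%:Z).

(** The weight [(m - |i|) * (n - |j|)] is the number of ordered pairs of grid points with difference
    [(i, j)]. *)
Lemma fq_card (q m n : nat) :
  fq q m n = #|[set u : ('I_m * 'I_n) * ('I_m * 'I_n) | grid_gcd u == q%:Z]|%:Z.
Proof.
pose F (i j : int) : int := (gcdz i j == q%:Z)%R%:R.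
transitivity (\sum_(i <- int_range m) (m%:Z - `|i|) *
    \sum_(j <- int_range n) (n%:Z - `|j|) * F i j).
  apply: eq_bigr => i _; rewrite big_mkcond mulr_sumr; apply: eq_bigr => j _.
  by rewrite /F; case: eqP => _; rewrite ?mulr1 ?mulr0.
rewrite -(sum_differences _ (fun i => \sum_(j <- int_range n) (n%:Z - `|j|) * F i j)).
rewrite -sum1_card -[RHS]natz natr_sum [RHS]big_mkcond /=.
pose G (p p' : 'I_m * 'I_n) := F (p'.1%:Z - p.1%:Z) (p'.2%:Z - p.2%:Z).
rewrite [RHS](eq_bigr (fun u => G u.1 u.2)); last first.
  by move=> u _; rewrite inE /G /F /grid_gcd; case: eqP.
rewrite -(pair_bigA _ G) /= -(pair_bigA _ (fun p1 p2 => \sum_p' G (p1, p2) p')) /=.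
apply: eq_bigr => p1 _.
under [RHS]eq_bigr => p2 _ do
  rewrite -(pair_bigA _ (fun q1 q2 => G (p1, p2) (q1, q2))) /=.
rewrite [RHS]exchange_big /=; apply: eq_bigr => q1 _.
by rewrite -sum_differences.
Qed.

(** * Lattice points on a segment of the grid *)

Section Grid.
Context (R : realType) (m n : nat).
Local Notation point := ('I_m * 'I_n)%type.

Definition gridx (y : point) : R := (y.1)%:R.
Definition gridy (y : point) : R := (y.2)%:R.

Lemma grid_inj (p q : point) : gridx p = gridx q -> gridy p = gridy q -> p = q.
Proof.
case: p q => [p1 p2] [q1 q2]; rewrite /gridx /gridy /=.
by move=> /(mulrIn (oner_neq0 _)) /val_inj -> /(mulrIn (oner_neq0 _)) /val_inj ->.
Qed.

Local Notation gsep := (separable gridx gridy setT).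
Local Notation gbetween := (between gridx gridy).

(** [(a, b)] is the primitive direction of the segment, with Bezout coefficients as the witness of
    coprimality. *)
Lemma grid_gcd_split (p q : point) : exists a b s t : int,
  [/\ q.1%:Z = p.1%:Z + grid_gcd (p, q) * a,
      q.2%:Z = p.2%:Z + grid_gcd (p, q) * b
    & p != q -> s * a + t * b = 1].
Proof.
pose dx := q.1%:Z - p.1%:Z; pose dy := q.2%:Z - p.2%:Z.
rewrite /grid_gcd /= -/dx -/dy.
have [/dvdzP[a Ea] /dvdzP[b Eb]] := conj (dvdz_gcdl dx dy) (dvdz_gcdr dx dy).
have [s [t st]] := Bezoutz dx dy.
exists a, b, s, t; split.
- by rewrite mulrC -Ea /dx; ring.
- by rewrite mulrC -Eb /dy; ring.
move=> npq; have g0 : gcdz dx dy != 0.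
  rewrite gcdz_eq0; apply: contraNN npq => /andP[/eqP e1 /eqP e2].
  have /val_inj E1 : p.1 = q.1 :> nat by rewrite /dx in e1; lia.
  have /val_inj E2 : p.2 = q.2 :> nat by rewrite /dy in e2; lia.
  by rewrite [p]surjective_pairing [q]surjective_pairing E1 E2.
by apply: (mulIf g0); rewrite mul1r mulrDl -!mulrA -Ea -Eb.
Qed.

Lemma grid_betweenP (p q y : point) (a b s t : int) :
  q.1%:Z = p.1%:Z + grid_gcd (p, q) * a ->
  q.2%:Z = p.2%:Z + grid_gcd (p, q) * b -> s * a + t * b = 1 ->
  gbetween p q y <-> exists2 k : int, 0 < k < grid_gcd (p, q) &
    y.1%:Z = p.1%:Z + k * a /\ y.2%:Z = p.2%:Z + k * b.
Proof.
set g := grid_gcd _ => Ea Eb st.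
have g0 : 0 <= g by [].
have nm : 0 < a ^+ 2 + b ^+ 2.
  rewrite lt_neqAle addr_ge0 ?sqr_ge0 // andbT eq_sym paddr_eq0 ?sqr_ge0 //.
  apply/negP; rewrite !sqrf_eq0 => /andP[/eqP a0 /eqP b0].
  by move: st; rewrite a0 b0 !mulr0.
have zr (x z : nat) : (x%:R - z%:R : R) = (x%:Z - z%:Z)%:~R by rewrite rmorphB.
pose u := y.1%:Z - p.1%:Z; pose v := y.2%:Z - p.2%:Z.
have crossE : cross gridx gridy p q y = (g * (a * v - b * u))%:~R.
  rewrite /cross /gridx /gridy !zr -!rmorphM -rmorphB; congr (_%:~R).
  by rewrite Ea Eb /u /v; ring.
have alongE : along gridx gridy p q y = (g * (a * u + b * v))%:~R.
  rewrite /along /gridx /gridy !zr -!rmorphM -rmorphD; congr (_%:~R).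
  by rewrite Ea Eb /u /v; ring.
have normE : along gridx gridy p q q = (g * (g * (a ^+ 2 + b ^+ 2)))%:~R.
  rewrite /along /gridx /gridy !zr -!rmorphM -rmorphD; congr (_%:~R).
  by rewrite Ea Eb; ring.
rewrite /between crossE alongE normE intr_eq0 ltr0z ltr_int.
split=> [/and3P[c0 l1 l2]|[k /andP[k0 kg] [Eu Ev]]]; last first.
  have uE : u = k * a by rewrite /u Eu; ring.
  have vE : v = k * b by rewrite /v Ev; ring.
  have gp : 0 < g by apply: lt_trans kg.
  rewrite uE vE (_ : a * (k * b) - b * (k * a) = 0); last by ring.
  rewrite mulr0 eqxx /=.
  rewrite (_ : a * (k * a) + b * (k * b) = k * (a ^+ 2 + b ^+ 2)); last by ring.
  by rewrite ltr_pM2l // ltr_pM2r // kg !mulr_gt0.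
have gp : 0 < g by rewrite lt_neqAle g0 andbT; apply: contraTneq l1 => <-; rewrite mul0r.
have {c0} c0 : a * v = b * u.
  by move: c0; rewrite mulf_eq0 (gt_eqF gp) /= subr_eq0 => /eqP.
(* By the Bezout identity, an integer vector [(u, v)] parallel to [(a, b)] is the integer multiple
   [s * u + t * v] of it. *)
pose k := s * u + t * v.
have uE : u = k * a.
  rewrite (_ : k * a = s * a * u + t * (a * v)); last by rewrite /k; ring.
  by rewrite c0 -[LHS]mul1r -st; ring.
have vE : v = k * b.
  rewrite (_ : k * b = s * (b * u) + t * b * v); last by rewrite /k; ring.
  by rewrite -c0 -[LHS]mul1r -st; ring.
exists k; last by rewrite -uE -vE /u /v; split; ring.
move: l1 l2; rewrite uE vE.
rewrite (_ : a * (k * a) + b * (k * b) = k * (a ^+ 2 + b ^+ 2)); last by ring.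
by rewrite ltr_pM2l // ltr_pM2r // pmulr_rgt0 // pmulr_lgt0 // => -> ->.
Qed.

(** The points strictly between are [p + k * (a, b)] for [0 < k < g]. Coincident points have gcd 0,
    for which the truncated predecessor correctly gives 0. *)
Lemma card_grid_between (p q : point) :
  #|[set y | gbetween p q y]| = (absz (grid_gcd (p, q))).-1.
Proof.
have [<-|npq] := eqVneq p q.
  rewrite /grid_gcd !subrr; apply: eq_card0 => y; rewrite inE.
  by apply/negP => /between_neq[]; rewrite eqxx.
have [a [b [s [t [Ea Eb /(_ npq) st]]]]] := grid_gcd_split p q.
have bP y := grid_betweenP y Ea Eb st.
set g := grid_gcd _ in Ea Eb bP *; have g0 : 0 <= g by [].
pose f (k : 'I_(absz g).-1) : point :=
  (insubd p.1 (absz (p.1%:Z + k.+1%:Z * a)), insubd p.2 (absz (p.2%:Z + k.+1%:Z * b))).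
(* The coordinates lie between those of [p] and [q], hence in range, so the defaults of [insubd] in
   [f] are never taken. *)
have conv (c k : int) (N x y : nat) : (x < N)%N -> (y < N)%N ->
    y%:Z = x%:Z + g * c -> 0 <= k <= g -> 0 <= x%:Z + k * c < N%:Z.
  move=> xN yN E /andP[k0 kg].
  have [c0|/ltW c0] := leP 0 c.
    have h1 : 0 <= k * c by rewrite mulr_ge0.
    have h2 : k * c <= g * c by rewrite ler_wpM2r.
    by apply/andP; split; lia.
  have h1 : k * c <= 0 by rewrite mulr_ge0_le0.
  have h2 : g * c <= k * c by rewrite ler_wnM2r.
  by apply/andP; split; lia.
have insubdE (N : nat) (i : 'I_N) (z : int) :
    0 <= z < N%:Z -> (insubd i (absz z))%:Z = z.
  by move=> zN; rewrite val_insubd; case: ifP; lia.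
have fE k : ((f k).1%:Z = p.1%:Z + k.+1%:Z * a) /\ ((f k).2%:Z = p.2%:Z + k.+1%:Z * b).
  have kg : 0 <= k.+1%:Z <= g by have := ltn_ord k; lia.
  have c1 := conv _ _ _ _ _ (ltn_ord p.1) (ltn_ord q.1) Ea kg.
  have c2 := conv _ _ _ _ _ (ltn_ord p.2) (ltn_ord q.2) Eb kg.
  by split; apply: insubdE.
have f_inj : injective f.
  move=> k l E; have [k1 k2] := fE k; have [l1 l2] := fE l.
  rewrite E in k1 k2.
  have h1 : (k.+1%:Z - l.+1%:Z) * a = 0 by rewrite mulrBl; lra.
  have h2 : (k.+1%:Z - l.+1%:Z) * b = 0 by rewrite mulrBl; lra.
  apply: ord_inj; suff : k.+1%:Z - l.+1%:Z = 0 by lia.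
  rewrite -[LHS]mulr1 -st mulrDr mulrCA h1 mulrCA h2 !mulr0; lia.
rewrite -[RHS]card_ord -(card_imset _ f_inj); apply: eq_card => y.
rewrite inE; apply/idP/imsetP => [/bP[k k0g [E1 E2]]|[k _ ->]].
  have lk : ((absz k).-1 < (absz g).-1)%N by lia.
  have kE : (absz k).-1.+1%:Z = k by lia.
  exists (Ordinal lk) => //; move: (f _) (fE (Ordinal lk)) => z.
  rewrite /= kE -E1 -E2 => -[[/ord_inj f1] [/ord_inj f2]].
  by rewrite [y]surjective_pairing [z]surjective_pairing f1 f2.
apply/bP; exists k.+1%:Z; last exact: fE.
by have := ltn_ord k; lia.
Qed.

(** No point lies between for gcd 0 or 1; distinctness of the ends excludes 0. *)
Lemma adjacent_pairs_grid :
  adjacent_pairs gridx gridy setT = [set u | grid_gcd u == 1].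
Proof.
apply/setP => -[p q]; rewrite [RHS]inE; apply/adjacent_pairsP/eqP.
  case=> _ _ npq adj; have := card_grid_between p q.
  rewrite eq_card0 => [g1|y]; last by rewrite inE; apply/negbTE/adj; rewrite inE.
  have : grid_gcd (p, q) != 0.
    have [a [b [s [t [Ea Eb _]]]]] := grid_gcd_split p q.
    apply: contraNneq npq => g0; move: Ea Eb; rewrite g0 !mul0r !addr0.
    case: (p) (q) => [p1 p2] [q1 q2] /= [e1] [e2].
    by apply/eqP; congr (_, _); apply: val_inj.
  have : 0 <= grid_gcd (p, q) by [].
  by move: (grid_gcd _) g1 => g; lia.
move=> g1; split; rewrite ?inE //.
  by apply: contra_eqN g1 => /eqP ->; rewrite /grid_gcd !subrr.
move=> y _; have /eqP := card_grid_between p q.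
rewrite g1 cards_eq0 => /eqP/setP/(_ y); by rewrite !inE => ->.
Qed.

Lemma midpoint_pairs_grid :
  [set u in setX setT setT | #|[set y in setT | gbetween u.1 u.2 y]| == 1%N]
  = [set u | grid_gcd u == 2].
Proof.
apply/setP => -[p q]; rewrite !inE /=.
rewrite (_ : [set y in setT | _] = [set y | gbetween p q y]); last first.
  by apply/setP => y; rewrite !inE.
rewrite card_grid_between; have : 0 <= grid_gcd (p, q) by [].
by move: (grid_gcd _) => g g0; apply/idP/idP; lia.
Qed.

(** * Threshold functions and teaching sets *)

Definition ones (g : {ffun point -> bool}) : {set point} := [set y | g y].

Lemma ones_inj : injective ones.
Proof. by move=> g h /setP E; apply/ffunP => y; have := E y; rewrite !inE. Qed.

Lemma thresholdsE g : (g \in thresholds R m n) = gsep (ones g).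
Proof.
rewrite inE; apply/asboolP/idP => [[a0 [a1 [a2 H]]]|].
  apply: (@separable_sign _ _ _ _ _ _ a1 a2 (- a0)); first exact: subsetT.
  move=> y _; rewrite inE /aff /gridx /gridy subr_gt0 ltNge.
  by case: (g y) (H y) => -[h1 h2]; [apply/esym/negP => /h2|rewrite h1].
case/separableP=> _ [a [b [c H]]]; exists (- c), a, b => y.
have := H y (in_setT y); rewrite /separates inE /aff /gridx /gridy.
by case: (g y) => h; split=> // h'; lra.
Qed.

Lemma separables_grid : separables gridx gridy setT = ones @: thresholds R m n.
Proof.
apply/setP => A; rewrite inE; apply/idP/imsetP => [sA|[g gT ->]]; last first.
  by rewrite -thresholdsE.
have AE : ones [ffun y => y \in A] = A by apply/setP => y; rewrite inE ffunE.
by exists [ffun y => y \in A]; rewrite ?thresholdsE AE.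
Qed.

Lemma card_thresholds : (0 < m)%N -> (0 < n)%N ->
  #|thresholds R m n|%:Z = fq 1 m n + 2.
Proof.
move=> m0 n0; rewrite -(card_imset _ ones_inj) -separables_grid.
rewrite card_separables; first by rewrite adjacent_pairs_grid fq_card -addn2 PoszD.
- exact: grid_inj.
- by apply/set0Pn; exists (Ordinal m0, Ordinal n0).
Qed.

(** If flipping [g] at [x] gives a threshold function, only [x] tells the two apart, so every
    teaching set contains [x]. By [separable_step], these points already form a teaching set, and
    minimality gives equality. *)
Lemma min_teaching_setE g : g \in thresholds R m n ->
  min_teaching_set R g = [set x | gsep (flip x (ones g))].
Proof.
move=> gT; set S := [set x | _].
pose gflip x : {ffun point -> bool} := [ffun y => g y (+) (y == x)].
have flipE x : ones (gflip x) = flip x (ones g).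
  by apply/setP => y; rewrite !inE ffunE.
have [/minsetP[tT minT]] := minset_min_teaching_set R g.
have SinT : S \subset min_teaching_set R g.
  apply/subsetP => x; rewrite inE -flipE -thresholdsE => fT.
  have /forall_inP/(_ _ fT)/implyP := tT.
  have nfg : gflip x != g.
    apply/eqP => /ffunP/(_ x); rewrite ffunE eqxx; by case: (g x).
  case/(_ nfg)/exists_inP => y yT; rewrite ffunE.
  by have [<-|] := eqVneq y x; rewrite // addbF eqxx.
apply/esym/minT => //; apply/forall_inP => h hT; apply/implyP => nhg.
rewrite !thresholdsE in gT hT.
have nE : ones g != ones h by rewrite (inj_eq ones_inj) eq_sym.
have [x xgh fx] := separable_step grid_inj gT hT nE.
by rewrite !inE in xgh; apply/exists_inP; exists x; rewrite ?inE.
Qed.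

(** Flips count each flippable pair twice, and the flippable pairs number
    [2 * fq 1 m n - fq 2 m n]. *)
Lemma sum_card_min_teaching_set : (1 < m)%N -> (1 < n)%N ->
  (\sum_(g in thresholds R m n) #|min_teaching_set R g|)%N%:Z
  = 4 * fq 1 m n - 2 * fq 2 m n.
Proof.
move=> m1 n1.
have -> : (\sum_(g in thresholds R m n) #|min_teaching_set R g|
    = \sum_(A in separables gridx gridy setT) #|[set x in setT | gsep (flip x A)]|)%N.
  rewrite separables_grid big_imset /=; last by move=> g h _ _; apply: ones_inj.
  apply: eq_bigr => g gT; rewrite min_teaching_setE //.
  by apply: eq_card => x; rewrite !inE.
rewrite sum_card_flips !fq_card -adjacent_pairs_grid -midpoint_pairs_grid.
rewrite -sum_card_midpoint_pairs.
have X1 : (1 < #|[set: point]|)%N.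
  by rewrite cardsT card_prod !card_ord; nia.
have := sum_card_flippable grid_inj X1.
by set a := (\sum_(x in _) _)%N; set b := (\sum_(x in _) _)%N; set c := #|_|; lia.
Qed.

End Grid.

Theorem theorem2 (R : realType) (m n : nat) (hm : (2 <= m)%N) (hn : (2 <= n)%N) :
  avg_teaching R m n =
    (4 * (fq 1 m n)%:~R - 2 * (fq 2 m n)%:~R) / ((fq 1 m n)%:~R + 2).
Proof.
have ratE (k : nat) : k%:R = (k%:Z)%:~R :> rat by [].
rewrite /avg_teaching (ratE (\sum_(g in _) _)%N) (ratE #|_|).
rewrite card_thresholds ?sum_card_min_teaching_set ?(ltnW hm) ?(ltnW hn) //.
by rewrite rmorphB rmorphD !rmorphM.
Qed.
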